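(* Let $\mathcal{G}$ and $\mathcal{H}$ be hypergraphs with incidence matrices $B$ and $C$, respectively. If there is a $k$-covering of $\mathcal{H}$ by $\mathcal{G}$, then, after suitable permutations of rows and columns, $B$ is a block matrix $\{D_{i,j}\}$ indexed by the vertices $i$ and hyperedges $j$ of $\mathcal{H}$. Each block $D_{i,j}$ is a permutation matrix of order $k$ if $c_{i,j}=1$, and the zero matrix of order $k$ if $c_{i,j}=0$.
   Context: Hypergraphs have finite vertex sets, and their hyperedges are distinct nonempty subsets of the vertex set. The incidence matrix has rows indexed by vertices and columns by hyperedges, with entry $1$ if the vertex lies in the hyperedge and $0$ otherwise. A covering of $\mathcal{H}$ by $\mathcal{G}$ is a surjective map $\varphi:X(\mathcal{G})\to X(\mathcal{H})$ with the following properties: - for every hyperedge $e$ of $\mathcal{G}$, $\varphi$ is injective on $e$ and $\varphi(e)=\{\varphi(x):x\in e\}$ is a hyperedge of $\mathcal{H}$; - for every vertex $x$, the map $e\mapsto\varphi(e)$ is a bijection from the hyperedges containing $x$ onto the hyperedges of $\mathcal{H}$ containing $\varphi(x)$. It is a $k$-covering if every vertex of $\mathcal{H}$ has exactly $k$ preimages under $\varphi$. *)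

(* Defs.v *)
From HB Require Import structures.
From mathcomp Require Import all_boot all_order all_fingroup all_algebra.

Set Implicit Arguments.
Unset Strict Implicit.
Unset Printing Implicit Defensive.

Import GRing.Theory.
Local Open Scope ring_scope.

Record hypergraph := Hypergraph {
  vertex : finType;
  hyperedges : {set {set vertex}};
  hyperedges_nonempty : set0 \notin hyperedges
}.

Definition incidence (R : nzRingType) (G : hypergraph) :
    'M[R]_(#|vertex G|, #|hyperedges G|) :=
  \matrix_(i, j) ((enum_val i \in (enum_val j : {set vertex G}))%:R).

Definition star (G : hypergraph) (x : vertex G) : {set {set vertex G}} :=
  [set e in hyperedges G | x \in e].

Definition covering (G H : hypergraph) (phi : vertex G -> vertex H) : Prop :=
  [/\ forall y : vertex H, exists x : vertex G, phi x = y,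
      forall e : {set vertex G}, e \in hyperedges G ->
        {in e &, injective phi} /\ phi @: e \in hyperedges H
    & forall x : vertex G,
        {in star x &, injective (fun e : {set vertex G} => phi @: e)} /\
        [set phi @: (e : {set vertex G}) | e in star x] = star (phi x)].

Definition k_covering (k : nat) (G H : hypergraph)
    (phi : vertex G -> vertex H) : Prop :=
  covering phi /\ forall y : vertex H, #|[set x | phi x == y]| = k.

(* Main.v *)
Require Import Defs.
From HB Require Import structures.
From mathcomp Require Import all_boot all_order all_fingroup all_algebra.

Import GRing.Theory.
Local Open Scope ring_scope.

(** Group the vertices of [G] by their image under the covering [phi], and the
    hyperedges of [G] by their image hyperedge.  If [y] is a vertex of a
    hyperedge [f] of [H], then incidence is a bijection between the vertices
    over [y] and the hyperedges over [f]: a vertex over [y] lies in exactly one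
    hyperedge over [f] since [phi] is bijective on stars, and a hyperedge over
    [f] contains exactly one vertex over [y] since [phi] is injective on it.
    Hence this block is a permutation matrix; as hyperedges are nonempty, every
    hyperedge of [H] also has [k] hyperedges above it, so the blocks are square.
    If [y] is not in [f], nothing over [y] meets anything over [f]. *)

(** Used for both rows and columns: sorting the indices by their [q]-class gives [n] consecutive
    blocks of length [k]. The permutation [s] sends a position in the sorted order to the original
    index, and [g i] enumerates the class of [i]. *)
Lemma equitable_partition_perm (m n k : nat) (q : 'I_m -> 'I_n) :
    (forall i, #|[set l | q l == i]| = k) ->
  exists (eqm : m = (\sum_(i < n) k)%N) (s : 'S_m) (g : 'I_n -> 'I_k -> 'I_m),
    [/\ forall i a, s (cast_ord (esym eqm) (@tagnat.Rank _ (fun=> k) i a)) = g i a,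
        forall i, injective (g i),
        forall i a, q (g i a) = i
      & forall l, exists a, l = g (q l) a].
Proof.
move=> cardq.
have eqm : m = (\sum_(i < n) k)%N.
  rewrite -[LHS]card_ord -sum1_card (partition_big q predT) //=.
  apply: eq_bigr => i _; rewrite -(cardq i) -sum1_card.
  by apply: eq_bigl => l; rewrite inE.
pose g i (a : 'I_k) : 'I_m := enum_val (cast_ord (esym (cardq i)) a).
have g_inj i : injective (g i).
  by move=> a b /enum_val_inj/cast_ord_inj.
have qg i a : q (g i a) = i.
  by have := enum_valP (cast_ord (esym (cardq i)) a); rewrite inE => /eqP.
(* A position is decoded as a pair (block, offset) and sent to the element of that class with that
   offset. Distinct blocks give distinct values of [q], so [h] is injective. *)
pose h (u : 'I_(\sum_(i < n) k)) : 'I_m :=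
  g (tag (@tagnat.sig _ (fun=> k) u)) (tagged (@tagnat.sig _ (fun=> k) u)).
have h_inj : injective h.
  move=> u v; rewrite /h => huv; apply: (can_inj (@tagnat.sigK _ (fun=> k))).
  case: (tagnat.sig u) (tagnat.sig v) huv => i a [j b] /= gab.
  have ij : i = j by rewrite -(qg i a) gab qg.
  by rewrite -{j}ij in b gab *; rewrite (g_inj _ _ _ gab).
have hc_inj : injective (h \o cast_ord eqm).
  by apply: inj_comp => //; apply: cast_ord_inj.
exists eqm, (perm hc_inj), g; split=> // [i a | l].
  by rewrite permE /= cast_ordKV /h /tagnat.Rank tagnat.rankK.
have l_in : l \in [set l' | q l' == q l] by rewrite inE.
exists (cast_ord (cardq (q l)) (enum_rank_in l_in l)).
by rewrite /g cast_ordK enum_rankK_in.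
Qed.

(** Such a relation is the graph of an injective self-map of a finite set, which is a
    permutation. *)
Lemma is_perm_mx_bijective_rel (R : nzRingType) (k : nat) (r : rel 'I_k) :
    (forall a, exists b, r a b) ->
    (forall a b b', r a b -> r a b' -> b = b') ->
    (forall a a' b, r a b -> r a' b -> a = a') ->
  is_perm_mx (\matrix_(a, b) (r a b)%:R : 'M[R]_k).
Proof.
move=> r_total r_fun r_inj; have [f rf] := fin_all_exists r_total.
have f_inj : injective f.
  by move=> a a' faa'; apply: (r_inj a a' (f a)) => //; rewrite faa'.
apply/is_perm_mxP; exists (perm f_inj); apply/matrixP => a b.
rewrite !mxE permE; case: eqP => [<- | fab]; first by rewrite rf.
by case rab: (r a b) => //; case: fab; apply: r_fun (rf a) rab.
Qed.

Lemma incidence1 (R : nzRingType) (G : hypergraph) i j :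
  incidence R G i j = 1 -> enum_val i \in enum_val j.
Proof.
by rewrite mxE; case: (_ \in _) => // /eqP; rewrite eq_sym oner_eq0.
Qed.

Lemma incidence0 (R : nzRingType) (G : hypergraph) i j :
  incidence R G i j = 0 -> enum_val i \notin enum_val j.
Proof. by rewrite mxE; case: (_ \in _) => // /eqP; rewrite oner_eq0. Qed.

Section Covering.

Variables (G H : hypergraph) (phi : vertex G -> vertex H).
Hypothesis phi_cov : covering phi.

Lemma covering_edge_exists (x : vertex G) (f : {set vertex H}) :
    f \in hyperedges H -> phi x \in f ->
  exists2 e : {set vertex G}, e \in star x & phi @: e = f.
Proof.
case: phi_cov => _ _ /(_ x)[_ im_star] fH xf.
have : f \in star (phi x) by rewrite inE fH.
by rewrite -im_star => /imsetP[e ex ->]; exists e.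
Qed.

Lemma covering_edge_unique (x : vertex G) (e e' : {set vertex G}) :
    e \in hyperedges G -> e' \in hyperedges G -> x \in e -> x \in e' ->
  phi @: e = phi @: e' -> e = e'.
Proof.
case: phi_cov => _ _ /(_ x)[inj_star _] eG e'G xe xe'.
by apply: inj_star; rewrite inE ?eG ?e'G.
Qed.

(** Fix [y] in [f]. Sending each edge over [f] to its vertex over [y] is a bijection onto the fiber
    of [y], which has [k] elements. *)
Lemma card_covering_edge_fiber (k : nat) (f : {set vertex H}) :
    (forall y, #|[set x | phi x == y]| = k) -> f \in hyperedges H ->
  #|[set e in hyperedges G | phi @: (e : {set vertex G}) == f]| = k.
Proof.
move=> cardphi fH.
have /set0Pn[y yf] : f != set0.
  by apply: contraTneq fH => ->; apply: hyperedges_nonempty.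
(* Stated for every set [e], so that a choice function [v] can be extracted; when [e] does not map
   to [f], an arbitrary vertex over [y] serves. *)
have vertex_over (e : {set vertex G}) :
    exists x, e \in hyperedges G -> phi @: e = f -> x \in e /\ phi x = y.
  have [ef | ef] := eqVneq (phi @: e) f.
    by move: (yf); rewrite -{1}ef => /imsetP[x xe ->]; exists x.
  have [x _] : exists x, phi x = y by case: phi_cov.
  by exists x => _ /eqP; rewrite (negPf ef).
have [v vP] := fin_all_exists vertex_over.
rewrite -(cardphi y); set E := [set e in _ | _].
have vE e : e \in E -> [/\ e \in hyperedges G, phi @: e = f, v e \in e & phi (v e) = y].
  by rewrite inE => /andP[eG /eqP ef]; have [] := vP e eG ef.
rewrite -(card_in_imset (f := v) (D := E)) => [|e e' /vE[eG ef ve _] /vE[e'G e'f ve' _] vee].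
  congr #|pred_of_set _|; apply/setP => x; rewrite inE; apply/imsetP/eqP.
    by case=> e /vE[_ _ _ <-] ->.
  (* Lift [f] to an edge [e] through [x]: both [x] and [v e] lie in [e] over [y], hence they
     agree. *)
  move=> xy; have [|e] := @covering_edge_exists x f fH; first by rewrite xy.
  rewrite inE => /andP[eG xe] ef.
  have eE : e \in E by rewrite inE eG ef eqxx.
  exists e => //; have [_ _ ve vy] := vE e eE.
  by case: phi_cov => _ /(_ e eG)[inj_e _] _; apply: inj_e; rewrite // xy vy.
by apply: (covering_edge_unique (v e)); rewrite ?ef ?e'f // vee.
Qed.

End Covering.

Theorem theorem9 (R : nzRingType) (G H : hypergraph) (k : nat) :
  (exists phi : vertex G -> vertex H, k_covering k phi) ->
  exists (eq_row : #|vertex G| = (\sum_(i < #|vertex H|) k)%N)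
         (eq_col : #|hyperedges G| = (\sum_(j < #|hyperedges H|) k)%N)
         (s : 'S_#|vertex G|) (t : 'S_#|hyperedges G|)
         (D : 'I_#|vertex H| -> 'I_#|hyperedges H| -> 'M[R]_k),
    castmx (eq_row, eq_col) (row_perm s (col_perm t (incidence R G))) =
      \mxblock_(i, j) D i j /\
    (forall (i : 'I_#|vertex H|) (j : 'I_#|hyperedges H|),
       (incidence R H i j = 1 -> is_perm_mx (D i j)) /\
       (incidence R H i j = 0 -> D i j = 0)).
Proof.
case=> phi [phi_cov cardphi].
pose q (l : 'I_#|vertex G|) : 'I_#|vertex H| := enum_rank (phi (enum_val l)).
have cardq i : #|[set l | q l == i]| = k.
  rewrite -(cardphi (enum_val i)) -(card_imset _ enum_val_inj).
  congr #|pred_of_set _|; apply/setP => x; rewrite inE.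
  apply/imsetP/eqP => [[l + ->] | xi].
    by rewrite inE => /eqP <-; rewrite enum_rankK.
  by exists (enum_rank x); rewrite ?inE /q enum_rankK // xi enum_valK.
have edge_im (l : 'I_#|hyperedges G|) :
    exists j : 'I_#|hyperedges H|, phi @: enum_val l = enum_val j.
  have [_ /(_ _ (enum_valP l))[_ fH] _] := phi_cov.
  by exists (enum_rank_in fH (phi @: enum_val l)); rewrite enum_rankK_in.
have [p pE] := fin_all_exists edge_im.
have cardp j : #|[set l | p l == j]| = k.
  rewrite -(card_covering_edge_fiber _ _ _ phi_cov k _ cardphi (enum_valP j)).
  rewrite -(card_imset _ enum_val_inj).
  congr #|pred_of_set _|; apply/setP => e; rewrite inE.
  apply/imsetP/andP => [[l + ->] | [eG /eqP ej]].
    by rewrite inE => /eqP <-; rewrite enum_valP pE.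
  exists (enum_rank_in eG e); rewrite ?inE ?enum_rankK_in //.
  by apply/eqP/enum_val_inj; rewrite -pE enum_rankK_in.
have [eqr [s [g [sE g_inj qg g_surj]]]] := equitable_partition_perm _ _ _ _ cardq.
have [eqc [t [h [tE h_inj ph h_surj]]]] := equitable_partition_perm _ _ _ _ cardp.
have phig i a : phi (enum_val (g i a)) = enum_val i.
  by rewrite -{2}(qg i a) enum_rankK.
have phih j b : phi @: enum_val (h j b) = enum_val j.
  by rewrite pE ph.
pose r i j : rel 'I_k := fun a b => enum_val (g i a) \in enum_val (h j b).
exists eqr, eqc, s, t, (fun i j => \matrix_(a, b) (r i j a b)%:R); split.
  (* Cut the permuted matrix into its blocks; entry [(a, b)] of block [(i, j)] is the incidence of
     [g i a] with [h j b]. *)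
  rewrite -[LHS](@submxblockK _ _ _ (fun=> k) (fun=> k)).
  apply: eq_mxblock => i j; apply/matrixP => a b.
  by rewrite mxE castmxE !mxE sE tE.
move=> i j; split=> [/incidence1 ij | /incidence0 ij]; last first.
  (* An incidence in this block would be carried by [phi] to an incidence of [i] with [j]. *)
  apply/matrixP => a b; rewrite !mxE; case ab: (r i j a b) => //.
  by case/negP: ij; rewrite -(phig i a) -(phih j b) imset_f.
apply: is_perm_mx_bijective_rel => [a | a b b' ab ab' | a a' b ab a'b].
(* Each row has a one by lifting edge [j] through the vertex [g i a], only one by injectivity on its
   star; each column has at most one by injectivity of [phi] on the edge [h j b]. *)
- have [|e] := covering_edge_exists _ _ _ phi_cov (enum_val (g i a)) _ (enum_valP j).
    by rewrite phig.
  rewrite inE => /andP[eG ae] ej; have [b eb] := h_surj (enum_rank_in eG e).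
  have pj : p (enum_rank_in eG e) = j.
    by apply: enum_val_inj; rewrite -pE enum_rankK_in.
  by exists b; rewrite /r -pj -eb enum_rankK_in.
- apply: (h_inj j); apply: enum_val_inj.
  by apply: (covering_edge_unique _ _ _ phi_cov (enum_val (g i a)));
     rewrite ?enum_valP ?phih.
apply: (g_inj i); apply: enum_val_inj.
have [_ /(_ _ (enum_valP (h j b)))[inj_e _] _] := phi_cov.
by apply: inj_e; rewrite ?phig.
Qed.
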